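(* Let $\{\xi_n\}_{n\ge0}$ be a positive martingale on the probability space $([0,1],\mathcal B,dx)$ adapted to the discrete time dyadic filtration $\mathcal F_0\subset\mathcal F_1\subset\cdots$, such that $\xi_N=\xi_{N+1}=\cdots=\xi_\infty>0$ for some sufficiently large $N$. Then $$\log\mathbb E\,\xi_\infty-\mathbb E\log\xi_\infty\le\mathbb E\, G\left(\frac{\xi_\infty}{[\xi_\infty]^{1/2}}\right),$$ where $[\xi_\infty]=\sum_{k\ge0}(\xi_{k+1}-\xi_k)^2$ is the quadratic variation and $$G(t)=\int_t^\infty\int_s^\infty r^{-2}e^{\frac{s^2-r^2}{2}}\,dr\,ds .$$
   Context: Dyadic filtration: for $n\ge0$, $\mathcal F_n$ is the $\sigma$-algebra on $[0,1)$ generated by the dyadic intervals $[k2^{-n},(k+1)2^{-n})$, $k=0,\dots,2^n-1$; in particular $\mathcal F_0$ is trivial. $\mathcal B$ is the Borel $\sigma$-algebra and $dx$ is Lebesgue measure. At points where $[\xi_\infty]=0$, the quantity $G(\xi_\infty/[\xi_\infty]^{1/2})$ is understood as $G(+\infty)=0$. *)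

(* Defs.v *)
From HB Require Import structures.
From mathcomp Require Import all_boot all_order all_algebra.
From mathcomp Require Import all_classical all_reals all_analysis.

Set Implicit Arguments.
Unset Strict Implicit.
Unset Printing Implicit Defensive.

Import Order.TTheory GRing.Theory Num.Theory.
Import numFieldNormedType.Exports.

Local Open Scope classical_set_scope.
Local Open Scope ring_scope.
Local Open Scope ereal_scope.

(* A random variable on the space (D, mu) is a total function on T of which
   only the values on D matter; a sub-sigma-algebra is a set of subsets of D. *)
Definition is_cond_exp (d : measure_display) (T : measurableType d)
    (R : realType) (mu : {measure set T -> \bar R}) (D : set T)
    (F : set (set T)) (X Y : T -> R) : Prop :=
  [/\ mu.-integrable D (EFin \o Y),
      preimage_set_system D Y measurable `<=` F &
      forall A, F A -> \int[mu]_(x in A) (Y x)%:E = \int[mu]_(x in A) (X x)%:E].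

Definition martingale (d : measure_display) (T : measurableType d)
    (R : realType) (mu : {measure set T -> \bar R}) (D : set T)
    (F : nat -> set (set T)) (xi : nat -> T -> R) : Prop :=
  (forall n, mu.-integrable D (EFin \o xi n) /\
             preimage_set_system D (xi n) measurable `<=` F n) /\
  (forall n, is_cond_exp mu D (F n) (xi n.+1) (xi n)).

Definition unit_itv (R : realType) : set R := [set` `[0%R, 1%R[].

(* The sigma-algebra on [0, 1[ (complements are relative to [0, 1[). *)
Definition dyadic_filtration (R : realType) (n : nat) : set (set R) :=
  <<s @unit_itv R, [set [set` dyadic_itv R n k] | k in [set k | (k < 2 ^ n)%N]] >>.

Definition expect (R : realType) (X : R -> \bar R) : \bar R :=
  \int[lebesgue_measure]_(x in @unit_itv R) X x.

Definition quad_var (R : realType) (xi : nat -> R -> R) (x : R) : \bar R :=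
  \sum_(0 <= k <oo) ((xi k.+1 x - xi k x) ^+ 2)%:E.

Definition G (R : realType) (t : \bar R) : \bar R :=
  \int[lebesgue_measure]_(s in [set s : R | t <= s%:E])
    \int[lebesgue_measure]_(r in [set r : R | (s <= r)%R])
      (r ^- 2 * expR ((s ^+ 2 - r ^+ 2) / 2))%:E.

Lemma G_pinfty (R : realType) : G (+oo : \bar R) = 0.
Proof.
rewrite /G (_ : [set s : R | +oo <= s%:E] = set0) ?integral_set0//.
by apply/seteqP; split => s //=; rewrite leye_eq.
Qed.

(* In \bar R one has 0^-1 = +oo, so a vanishing quadratic variation gives
   the argument +oo of G. *)
Lemma div_sqrte0 (R : realType) (a : R) :
  (0 < a)%R -> a%:E / sqrte 0 = +oo.
Proof. by move=> a0; rewrite sqrte0 inve0 gt0_muley. Qed.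

(* Main.v *)
(* Since [cosh x <= exp (x^2 / 2)], for every [u > 0] the process
   [exp (- u xi_n - u^2 [xi]_n / 2)] is a supermartingale for the dyadic
   filtration, so that
     [E exp (- u xi_inf - u^2 [xi_inf] / 2) <= exp (- u E xi_inf)].
   Integrating this against [du / u] over [u > 0] gives the theorem, because of
   Frullani's formula
     [ln c - ln b = \int (exp (- u b) - exp (- u c)) / u du]
   and of its analogue
     [G (p / A^(1/2)) = \int exp (- u p) (1 - exp (- u^2 A / 2)) / u du].
   All logarithms are compared with [ln c] for one constant [c] that exceeds
   every value of the martingale, which keeps the integrands nonnegative. *)
Require Import Defs.
From HB Require Import structures.
From mathcomp Require Import all_boot all_order all_algebra.
From mathcomp Require Import all_classical all_reals all_analysis.
From mathcomp Require Import measurable_realfun ring lra.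

Set Implicit Arguments.
Unset Strict Implicit.
Unset Printing Implicit Defensive.

Import Order.TTheory GRing.Theory Num.Theory.
Import numFieldNormedType.Exports.

Local Open Scope classical_set_scope.
Local Open Scope ring_scope.
Local Open Scope ereal_scope.

(** * Elementary bounds and integrals of exponentials *)

Section laplace.
Context {R : realType}.
Local Open Scope ring_scope.
Local Notation mu := (@lebesgue_measure R).

Lemma is_derive_continuous (f : R -> R) (x df : R) :
  is_derive x 1 f df -> {for x, continuous f}.
Proof.
by move=> fx; apply: differentiable_continuous; apply/derivable1_diffP.
Qed.

Lemma cvgy_expRNM (k : R) : 0 < k -> expR (- (x * k)) @[x --> +oo] --> 0.
Proof.
move=> k0.
apply: (@cvg_comp _ _ _ ( *%R^~ k) (fun x => expR (- x)) +oo (pinfty_nbhs R)).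
  by apply: gt0_cvgMly => //; exact: cvg_id.
exact: cvgr_expR.
Qed.

(** By parity one may take x >= 0. There 2 exp (- x^2 / 2) cosh x is nonincreasing and equals 2 at
    0: its derivative has the sign of (1 - x) exp x - (1 + x) exp (- x), which is at most 0 by a
    second monotonicity argument ([psi]). *)
Lemma expR_cosh_le (x : R) : expR x + expR (- x) <= 2 * expR (x ^+ 2 / 2).
Proof.
wlog x0 : x / 0 <= x => [hw|].
  have [/hw//|x0] := leP 0 x.
  by rewrite -(sqrrN x) addrC -{2}(opprK x) hw// oppr_ge0 ltW.
have psi_le (y : R) : 0 <= y -> (1 - y) * expR y <= (1 + y) * expR (- y).
  move=> y0; rewrite -subr_ge0.
  pose psi (z : R) := (1 + z) * expR (- z) - (1 - z) * expR z.
  have dpsi (z : R) : is_derive z 1 psi (z * (expR z - expR (- z))).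
    by apply: is_derive_eq; rewrite /GRing.scale/=; ring.
  rewrite -/(psi y) (_ : 0 = psi 0); last by rewrite /psi oppr0 expR0; ring.
  apply: (@ger0_derive1_ndecry _ psi 0) => //.
  - by move=> z; rewrite in_itv/= andbT derive1E derive_val => z0;
      apply: mulr_ge0; rewrite ?subr_ge0 ?ler_expR; lra.
  - apply: continuous_subspaceT => z.
    exact: is_derive_continuous.
pose phi (z : R) := expR (- (z ^+ 2 / 2)) * (expR z + expR (- z)).
have dphi (z : R) : is_derive z 1 phi
    (expR (- (z ^+ 2 / 2)) * ((1 - z) * expR z - (1 + z) * expR (- z))).
  by apply: is_derive_eq; rewrite /GRing.scale/=; field.
have : phi x <= phi 0.
  apply: (@ler0_derive1_nincry _ phi 0) => //.
  - move=> z; rewrite in_itv/= andbT derive1E derive_val => z0.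
    by rewrite mulr_ge0_le0 ?expR_ge0// subr_le0 psi_le// ltW.
  - apply: continuous_subspaceT => z.
    exact: is_derive_continuous.
rewrite /phi expr0n/= mul0r oppr0 expR0 mul1r expRN mulrC ler_pdivrMr ?expR_gt0//.
Qed.

(** Extending [f] by zero outside [D1]*[D2] reduces the exchange to Tonelli's theorem on the whole
    product. *)
Lemma tonelli_in d1 d2 (T1 : measurableType d1) (T2 : measurableType d2)
    (m1 : {sigma_finite_measure set T1 -> \bar R})
    (m2 : {sigma_finite_measure set T2 -> \bar R})
    (D1 : set T1) (D2 : set T2) (f : T1 * T2 -> \bar R) :
  measurable D1 -> measurable D2 -> measurable_fun setT f ->
  (forall z, (0 <= f z)%E) ->
  (\int[m1]_(x in D1) \int[m2]_(y in D2) f (x, y) =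
   \int[m2]_(y in D2) \int[m1]_(x in D1) f (x, y))%E.
Proof.
move=> mD1 mD2 mf f0; pose g := f \_ (D1 `*` D2).
have g0 z : (0 <= g z)%E by rewrite /g patchE; case: ifP.
have mg : measurable_fun setT g.
  apply/(measurable_restrictT _ (measurableX mD1 mD2)).
  exact: measurable_funTS.
transitivity (\int[m1]_x \int[m2]_y g (x, y))%E.
  rewrite integral_mkcond; apply: eq_integral => x _.
  rewrite patchE; case: ifPn => [xD1|xD1].
    rewrite integral_mkcond; apply: eq_integral => y _.
    by rewrite /g !patchE in_setX xD1.
  by rewrite integral0_eq// => y _; rewrite /g patchE in_setX (negbTE xD1).
rewrite fubini_tonelli//.
rewrite [RHS]integral_mkcond; apply: eq_integral => y _.
rewrite patchE; case: ifPn => [yD2|yD2].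
  rewrite [RHS]integral_mkcond; apply: eq_integral => x _.
  by rewrite /g !patchE in_setX yD2 andbT.
by rewrite integral0_eq// => x _; rewrite /g patchE in_setX (negbTE yD2) andbF.
Qed.

Lemma integral_expR_tail (s a : R) : 0 < s ->
  (\int[mu]_(x in `[a, +oo[) (expR (- (x * s)))%:E =
   (expR (- (a * s)) / s)%:E)%E.
Proof.
move=> s0; pose F (x : R) := - (expR (- (x * s)) / s).
have dF (x : R) : is_derive x 1 F (expR (- (x * s))).
  by apply: is_derive_eq; rewrite /GRing.scale/=; field; rewrite gt_eqF.
rewrite (@ge0_continuous_FTC2y _ _ F _ 0).
- by rewrite -EFinB /F sub0r opprK.
- by move=> x _; exact: expR_ge0.
- apply: continuous_subspaceT => x.
  exact: is_derive_continuous.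
- rewrite -oppr0 -(mul0r s^-1); apply: cvgN; apply: cvgMr_tmp.
  exact: cvgy_expRNM.
- by [].
- apply: cvg_at_right_filter.
  exact: is_derive_continuous.
- by move=> x _; rewrite derive1E derive_val.
Qed.

(** Integrands with a factor 1 / u are continuous only away from 0, so continuity is asked on the
    open half-line alone. *)
Lemma measurable_fun_gt0 (f : R -> R) :
  (forall x, 0 < x -> {for x, continuous f}) ->
  measurable_fun (`]0, +oo[ : set R) (EFin \o f).
Proof.
move=> cf; apply/measurable_EFinP; apply: open_continuous_measurable_fun => //.
by move=> x; rewrite inE/= in_itv/= andbT => /cf.
Qed.

Lemma integral_expR_itv (u b c : R) : 0 < u -> b <= c ->
  (\int[mu]_(x in `[b, c]) (expR (- (u * x)))%:E =
   ((expR (- (u * b)) - expR (- (u * c))) / u)%:E)%E.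
Proof.
move=> u0; rewrite le_eqVlt => /predU1P[->|bc].
  by rewrite set_itv1 integral_set1 subrr mul0r.
pose F (x : R) := - (expR (- (u * x)) / u).
have dF (x : R) : is_derive x 1 F (expR (- (u * x))).
  by apply: is_derive_eq; rewrite /GRing.scale/=; field; rewrite gt_eqF.
rewrite (@continuous_FTC2 _ _ F)//.
- by rewrite -EFinB /F; congr EFin; field; rewrite gt_eqF.
- by apply: continuous_subspaceT => x; apply: is_derive_continuous.
- split=> //; [apply: cvg_at_right_filter|apply: cvg_at_left_filter];
  exact: is_derive_continuous.
- by move=> x _; rewrite derive1E derive_val.
Qed.

Lemma integral_inv_itv (b c : R) : 0 < b -> b <= c ->
  (\int[mu]_(x in `[b, c]) (x^-1)%:E = (ln c - ln b)%:E)%E.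
Proof.
move=> b0; rewrite le_eqVlt => /predU1P[->|bc].
  by rewrite set_itv1 integral_set1 subrr.
have dln (x : R) : b <= x -> is_derive x 1 (@ln R) x^-1.
  by move=> bx; apply: is_derive1_ln; exact: lt_le_trans bx.
rewrite (@continuous_FTC2 _ _ (@ln R))//.
- apply: continuous_in_subspaceT => x; rewrite inE/= in_itv/= => /andP[bx _].
  by apply: inv_continuous; rewrite gt_eqF// (lt_le_trans b0).
- split.
  + by move=> x; rewrite in_itv/= => /andP[/ltW/dln].
  + by apply: cvg_at_right_filter; apply: is_derive_continuous; exact: dln.
  + by apply: cvg_at_left_filter; apply: is_derive_continuous; apply: dln; exact: ltW.
- move=> x; rewrite in_itv/= => /andP[/ltW/dln ? _].
  by rewrite derive1E derive_val.
Qed.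

(** A point is a null set. Integrals against du / u live on the open half-line, whereas primitives
    are evaluated on the closed one. *)
Lemma integral_gt0_ge0 (f : R -> R) :
  measurable_fun (`]0, +oo[ : set R) (EFin \o f) ->
  (\int[mu]_(x in `]0%R, +oo[) (f x)%:E =
   \int[mu]_(x in `[0%R, +oo[) (f x)%:E)%E.
Proof. by move=> mf; rewrite integral_itv_obnd_cbnd. Qed.

Lemma measurable_expRM :
  measurable_fun [set: R * R] (fun z => (expR (- (z.1 * z.2)))%:E).
Proof.
apply/measurable_EFinP; apply: measurableT_comp => //.
by apply: measurableT_comp => //; apply: measurable_funM.
Qed.

(** The integrand is the integral of exp (- u s) over s in [b, c]. After the exchange the inner
    integral over u is 1 / s. *)
Lemma frullani_expR (b c : R) : 0 < b -> b <= c ->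
  (\int[mu]_(u in `]0%R, +oo[) ((expR (- (u * b)) - expR (- (u * c))) / u)%:E =
   (ln c - ln b)%:E)%E.
Proof.
move=> b0 bc; rewrite -integral_inv_itv//.
transitivity (\int[mu]_(u in `]0%R, +oo[)
    \int[mu]_(s in `[b, c]) (expR (- (u * s)))%:E)%E.
  apply: eq_integral => u; rewrite inE/= in_itv/= andbT => u0.
  by rewrite integral_expR_itv.
rewrite (tonelli_in mu mu (f := fun z => (expR (- (z.1 * z.2)))%:E))//=;
  last exact: measurable_expRM.
apply: eq_integral => s; rewrite inE/= in_itv/= => /andP[bs _].
have s0 := lt_le_trans b0 bs.
rewrite (integral_gt0_ge0 (f := fun u => expR (- (u * s)))).
  by rewrite integral_expR_tail// mul0r oppr0 expR0 mul1r.
by apply: measurable_fun_gt0 => x _; apply: is_derive_continuous.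
Qed.

(** * Laplace representation of [G] *)

Lemma onem_expRN_ge0 (A u : R) : 0 <= A -> 0 <= 1 - expR (- (u ^+ 2 * A / 2)).
Proof.
move=> A0; rewrite subr_ge0 -expR0 ler_expR oppr_le0 divr_ge0// mulr_ge0//.
exact: sqr_ge0.
Qed.

(* Substituting [r = s + c u] and adding [\int c exp (- c s u - c^2 u^2 / 2) du]
   to either side yields [s^-1]: on the left by the explicit primitive [P], on
   the right because the sum is [\int c exp (- c s u) du]. *)
Lemma mills_laplace (s c : R) : 0 < s -> 0 < c ->
  (\int[mu]_(r in `[s, +oo[) (r ^- 2 * expR ((s ^+ 2 - r ^+ 2) / 2))%:E =
   \int[mu]_(u in `]0%R, +oo[)
     (c * (expR (- (u * (c * s))) * (1 - expR (- (u ^+ 2 * c ^+ 2 / 2)))))%:E)%E.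
Proof.
move=> s0 c0.
pose F (u : R) := c * u + s.
have F0 (u : R) : 0 <= u -> 0 < F u.
  by move=> u0; rewrite /F ltr_wpDl// mulr_ge0// ltW.
have dF (u : R) : is_derive u 1 F c.
  by apply: is_derive_eq; rewrite /GRing.scale/=; ring.
have dF1 : (F^`())%classic = cst c.
  by apply/funext => u; rewrite derive1E derive_val.
pose g (r : R) := r ^- 2 * expR ((s ^+ 2 - r ^+ 2) / 2).
have g0 (r : R) : 0 <= g r by rewrite mulr_ge0 ?expR_ge0// invr_ge0 sqr_ge0.
have cg (r : R) : 0 < r -> {for r, continuous g}.
  move=> r0; apply: continuousM.
    apply: continuousV; first by rewrite expf_neq0// gt_eqF.
    exact: exprn_continuous.
  exact: is_derive_continuous.
(* This is exp ((s^2 - (F u)^2) / 2), the exponential factor of [g] after the substitution. *)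
pose E (u : R) := expR (- (u * (c * s)) - u ^+ 2 * c ^+ 2 / 2).
have dE (u : R) : is_derive u 1 E (- (c * (s + c * u)) * E u).
  by apply: is_derive_eq; rewrite /GRing.scale/= /E; field.
(* Differentiating [E] gives - c F E, whose factor F cancels the denominator and leaves the term c
   E; differentiating 1 / F gives c E / F^2, the substituted integrand. *)
pose P (u : R) := - (E u / F u).
pose p (u : R) := g (F u) * c + c * E u.
have gF (u : R) : g (F u) = (F u) ^- 2 * E u.
  by rewrite /g /E; congr (_ * expR _); rewrite /F; field.
have dP (u : R) : 0 <= u -> is_derive u 1 P (p u).
  move=> u0; have Fu := F0 u u0.
  have Fn : F u != 0 by rewrite gt_eqF.
  apply: is_derive_eq; rewrite /GRing.scale/= /p gF.
  have -> : s + c * u = F u by rewrite /F addrC.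
  by field.
have cgF (u : R) : 0 <= u -> {for u, continuous (fun u => g (F u) * c)}.
  move=> u0; apply: continuousM; last exact: cst_continuous.
  apply: continuous_comp; first exact: is_derive_continuous.
  by apply: cg; exact: F0.
have cE (u : R) : {for u, continuous (fun u => c * E u)}.
  by apply: is_derive_continuous.
have mgF : measurable_fun (`]0, +oo[ : set R) (EFin \o (fun u => g (F u) * c)).
  by apply: measurable_fun_gt0 => u /ltW; exact: cgF.
have mE : measurable_fun (`]0, +oo[ : set R) (EFin \o (fun u => c * E u)).
  by apply: measurable_fun_gt0 => u _; exact: cE.
have X_subst : (\int[mu]_(r in `[s, +oo[) (g r)%:E =
    \int[mu]_(u in `]0%R, +oo[) (g (F u) * c)%:E)%E.
  have {1}-> : s = F 0 by rewrite /F mulr0 add0r.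
  rewrite increasing_ge0_integration_by_substitutiony//.
  - rewrite integral_gt0_ge0//.
    by apply: eq_integral => u _; rewrite dF1.
  - by move=> x y _ _ xy; rewrite ltrD2r ltr_pM2l.
  - by rewrite dF1 => x _; exact: cst_continuous.
  - by rewrite dF1; exact: is_cvg_cst.
  - by rewrite dF1; exact: is_cvg_cst.
  - split; first by [].
    by apply: cvg_at_right_filter; exact: is_derive_continuous.
  - apply: (@cvg_comp _ _ _ ( *%R c) (+%R^~ s) +oo (pinfty_nbhs R)).
      by apply: gt0_cvgMry => //; exact: cvg_id.
    exact: cvg_addrr.
  - apply: continuous_in_subspaceT => x; rewrite inE/= in_itv/= andbT => F0x.
    by apply: cg; apply: lt_le_trans F0x; exact: F0.
have XY : (\int[mu]_(u in `]0%R, +oo[) (g (F u) * c)%:E +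
    \int[mu]_(u in `]0%R, +oo[) (c * E u)%:E = (s^-1)%:E)%E.
  rewrite -ge0_integralD//; last 2 first.
  - by move=> u _; rewrite lee_fin mulr_ge0// ltW.
  - by move=> u _; rewrite lee_fin mulr_ge0 ?expR_ge0// ltW.
  transitivity (\int[mu]_(u in `]0%R, +oo[) (p u)%:E)%E.
    by apply: eq_integral => u _; rewrite -EFinD.
  rewrite integral_gt0_ge0; last exact: (emeasurable_funD mgF mE).
  rewrite (@ge0_continuous_FTC2y _ _ P _ 0).
  - rewrite -EFinB /P /E /F !mulr0 expr0n/= !mul0r subr0 oppr0 expR0.
    by rewrite sub0r opprK add0r mul1r.
  - by move=> u u0; rewrite addr_ge0// mulr_ge0 ?expR_ge0// ltW.
  - apply: continuous_in_subspaceT => u; rewrite inE/= in_itv/= andbT => u0.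
    exact: (cvgD (cgF _ u0) (cE u)).
  (* The primitive vanishes at infinity because [E u] is at most exp (- u c s) and [F u] is at least
     [s]. *)
  - rewrite -oppr0; apply: cvgN.
    apply: (@squeeze_cvgr _ _ _ _ (cst 0)
      (fun u => expR (- (u * (c * s))) * s^-1)).
    + near=> u.
      have u0 : 0 <= u by near: u; exact: nbhs_pinfty_ge.
      rewrite divr_ge0 ?expR_ge0//=; last exact/ltW/F0.
      rewrite ler_pM ?expR_ge0 ?invr_ge0//; first exact/ltW/F0.
        by rewrite /E ler_expR lerBlDr lerDl divr_ge0// mulr_ge0 ?sqr_ge0.
      by rewrite lef_pV2 ?posrE ?F0// lerDr mulr_ge0// ltW.
    + exact: cvg_cst.
    + rewrite -[X in _ --> X](mul0r s^-1); apply: cvgMr_tmp; apply: cvgy_expRNM.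
      exact: mulr_gt0.
  - by move=> u /ltW/dP.
  - by apply: cvg_at_right_filter; exact: (is_derive_continuous (dP 0 (lexx 0))).
  - move=> u; rewrite in_itv/= andbT => /ltW/dP ?.
    by rewrite derive1E derive_val.
have ZY : (\int[mu]_(u in `]0%R, +oo[)
     (c * (expR (- (u * (c * s))) * (1 - expR (- (u ^+ 2 * c ^+ 2 / 2)))))%:E +
    \int[mu]_(u in `]0%R, +oo[) (c * E u)%:E = (s^-1)%:E)%E.
  rewrite -ge0_integralD//; last 3 first.
  - move=> u _; rewrite lee_fin mulr_ge0 ?(ltW c0)// mulr_ge0 ?expR_ge0//.
    by rewrite onem_expRN_ge0 ?sqr_ge0.
  - by apply: measurable_fun_gt0 => u _; apply: is_derive_continuous.
  - by move=> u _; rewrite lee_fin mulr_ge0 ?expR_ge0// ltW.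
  transitivity (\int[mu]_(u in `]0%R, +oo[)
      (c%:E * (expR (- (u * (c * s))))%:E))%E.
    apply: eq_integral => u _; rewrite -EFinD -EFinM; congr EFin.
    by rewrite /E expRD; ring.
  have me : measurable_fun (`]0, +oo[ : set R)
      (EFin \o (fun u => expR (- (u * (c * s))))).
    by apply: measurable_fun_gt0 => u _; apply: is_derive_continuous.
  rewrite ge0_integralZl//; last by rewrite lee_fin ltW.
  rewrite integral_gt0_ge0// integral_expR_tail ?mulr_gt0//.
  rewrite mul0r oppr0 expR0 -EFinM; congr EFin; field.
  by rewrite !gt_eqF.
(* The common summand can be cancelled in [\bar R] only if it is finite; it is, as part of a sum
   equal to the real number 1 / s. *)
have Yfin : (\int[mu]_(u in `]0%R, +oo[) (c * E u)%:E)%E \is a fin_num.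
  have : (s^-1)%:E \is a fin_num by [].
  by rewrite -XY fin_numD => /andP[].
by rewrite X_subst -[LHS](addeK _ Yfin) XY -ZY addeK.
Unshelve. all: by end_near. Qed.

(** The loss from exp (- u p) to exp (- u p - u^2 A / 2), as a density against du / u. *)
Definition laplace_gap (p A u : R) : R :=
  expR (- (u * p)) * (1 - expR (- (u ^+ 2 * A / 2))) / u.

(** For A > 0, apply [mills_laplace] with c = A^(1/2) and exchange the integrals: over s >= p / c
    the factor exp (- u c s) integrates to exp (- u p) / (u c), whence the 1 / u. For A = 0 both
    sides vanish. *)
Lemma G_sqrt_laplace (p A : R) : 0 < p -> 0 <= A ->
  G (p%:E / sqrte A%:E) =
  (\int[mu]_(u in `]0%R, +oo[) (laplace_gap p A u)%:E)%E.
Proof.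
move=> p0; rewrite le_eqVlt => /predU1P[<-|A0].
  rewrite div_sqrte0// G_pinfty integral0_eq// => u _.
  by rewrite /laplace_gap mulr0 mul0r oppr0 expR0 subrr mulr0 mul0r.
pose c := Num.sqrt A; have c0 : 0 < c by rewrite sqrtr_gt0.
have cA : c ^+ 2 = A by rewrite sqr_sqrtr// ltW.
rewrite /= inver gt_eqF// -EFinM /G.
pose f (z : R * R) :=
  c * (expR (- (z.2 * (c * z.1))) * (1 - expR (- (z.2 ^+ 2 * c ^+ 2 / 2)))).
have f0 z : 0 <= f z.
  rewrite mulr_ge0 ?(ltW c0)// mulr_ge0 ?expR_ge0//.
  by rewrite onem_expRN_ge0 ?sqr_ge0.
have mf : measurable_fun setT (EFin \o f).
  apply/measurable_EFinP; apply: measurable_funM => //.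
  apply: measurable_funM.
    apply: measurableT_comp => //; apply: measurableT_comp => //.
    by apply: measurable_funM => //; apply: measurable_funM.
  apply: measurable_funB => //.
  apply: measurableT_comp => //; apply: measurableT_comp => //.
  apply: measurable_funM => //; apply: measurable_funM => //.
  exact: measurable_funX.
have -> : [set s : R | ((p / c)%:E <= s%:E)%E] = `[p / c, +oo[%classic.
  by apply/seteqP; split => s /=; rewrite in_itv/= andbT lee_fin.
transitivity (\int[mu]_(s in `[(p / c)%R, +oo[)
    \int[mu]_(u in `]0%R, +oo[) (f (s, u))%:E)%E.
  apply: eq_integral => s; rewrite inE/= in_itv/= andbT => ps.
  have s0 : 0 < s by rewrite (lt_le_trans _ ps)// divr_gt0.
  rewrite -mills_laplace//; congr integral.
  by apply/seteqP; split => r /=; rewrite in_itv/= andbT.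
rewrite (tonelli_in mu mu (f := fun z => (f z)%:E))//=.
apply: eq_integral => u; rewrite inE/= in_itv/= andbT => u0.
(* The factor of the integrand that does not depend on [s]. *)
pose k := c * (1 - expR (- (u ^+ 2 * c ^+ 2 / 2))).
have k0 : 0 <= k.
  by rewrite mulr_ge0 ?(ltW c0)// onem_expRN_ge0 ?sqr_ge0.
transitivity (\int[mu]_(s in `[(p / c)%R, +oo[)
    (k%:E * (expR (- (s * (u * c))))%:E))%E.
  apply: eq_integral => s _; rewrite -EFinM /f/= /k; congr EFin.
  have -> : s * (u * c) = u * (c * s) by ring.
  by ring.
rewrite ge0_integralZl//; last first.
- apply/measurable_EFinP; apply: measurable_funTS.
  by apply: continuous_measurable_fun => x; apply: is_derive_continuous.
rewrite integral_expR_tail ?mulr_gt0//.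
rewrite -EFinM /laplace_gap /k cA; congr EFin.
have -> : p / c * (u * c) = u * p by field; rewrite gt_eqF.
by field; rewrite !gt_eqF.
Qed.

(** * Integration of the supermartingale bound against du / u *)

Lemma measurable_frullani (b c : R) :
  measurable_fun (`]0, +oo[ : set R)
    (EFin \o (fun u => (expR (- (u * b)) - expR (- (u * c))) / u)).
Proof.
apply: measurable_fun_gt0 => u u0; apply: continuousM.
  exact: is_derive_continuous.
by apply: inv_continuous; rewrite gt_eqF.
Qed.

Lemma measurable_laplace_gap (p A : R) :
  measurable_fun (`]0, +oo[ : set R) (EFin \o laplace_gap p A).
Proof.
apply: measurable_fun_gt0 => u u0; apply: continuousM.
  exact: is_derive_continuous.
by apply: inv_continuous; rewrite gt_eqF.
Qed.

Lemma laplace_gap_ge0 (p A u : R) : 0 <= A -> 0 < u -> 0 <= laplace_gap p A u.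
Proof.
move=> A0 u0; rewrite divr_ge0 ?(ltW u0)// mulr_ge0 ?expR_ge0//.
exact: onem_expRN_ge0.
Qed.

Lemma frullani_ge0 (b c u : R) : b <= c -> 0 < u ->
  0 <= (expR (- (u * b)) - expR (- (u * c))) / u.
Proof.
move=> bc u0.
by rewrite divr_ge0 ?(ltW u0)// subr_ge0 ler_expR lerN2 ler_pM2l.
Qed.

(** The theorem for a random variable with finitely many values [p i] of probability [w i],
    quadratic variation [A i] and mean [P]; the last hypothesis is what the supermartingale provides
    for each u. *)
Lemma ln_sub_mean_ln_le_G (I : finType) (w p A : I -> R) (P : R) :
  (forall i, 0 <= w i) -> \sum_i w i = 1 ->
  (forall i, 0 < p i) -> (forall i, 0 <= A i) -> 0 < P ->
  (forall u, 0 < u ->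
    \sum_i w i * expR (- (u * p i) - u ^+ 2 * A i / 2) <= expR (- (u * P))) ->
  ((ln P - \sum_i w i * ln (p i))%:E <=
    \sum_i (w i)%:E * G ((p i)%:E / sqrte (A i)%:E))%E.
Proof.
move=> w0 w1 p0 A0 P0 supmart.
(* Any common upper bound of [P] and the [p i] would do; a sum of positive numbers is one. *)
pose c := P + \sum_i p i.
have Pc : P <= c by rewrite lerDl sumr_ge0// => i _; exact: ltW.
have pc i : p i <= c.
  rewrite /c (bigD1 i)//= addrCA lerDl addr_ge0 ?(ltW P0)// sumr_ge0// => j _.
  exact: ltW.
pose K b u := (expR (- (u * b)) - expR (- (u * c))) / u.
have gt0 (u : R) : (`]0, +oo[%classic : set R) u -> 0 < u.
  by rewrite /= in_itv/= andbT.
(* The terms are distributed so that both sides are integrals of nonnegative functions of u, to be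
   compared pointwise. *)
have key : (\sum_i (w i)%:E * (ln c - ln (p i))%:E <=
    (ln c - ln P)%:E + \sum_i (w i)%:E * G ((p i)%:E / sqrte (A i)%:E))%E.
  rewrite -(frullani_expR P0 Pc).
  under eq_bigr => i _ do rewrite -(frullani_expR (p0 i) (pc i)).
  under [X in (_ <= _ + X)%E]eq_bigr => i _ do rewrite G_sqrt_laplace//.
  have mwK i : measurable_fun (`]0, +oo[ : set R)
      (fun u => (w i)%:E * (K (p i) u)%:E)%E.
    by apply: measurable_funeM; exact: measurable_frullani.
  have mwL i : measurable_fun (`]0, +oo[ : set R)
      (fun u => (w i)%:E * (laplace_gap (p i) (A i) u)%:E)%E.
    by apply: measurable_funeM; exact: measurable_laplace_gap.
  have wL0 i u : (`]0, +oo[%classic : set R) u ->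
      (0 <= (w i)%:E * (laplace_gap (p i) (A i) u)%:E)%E.
    by move=> /gt0 u0; rewrite mule_ge0 ?lee_fin ?laplace_gap_ge0.
  have wK0 i u : (`]0, +oo[%classic : set R) u ->
      (0 <= (w i)%:E * (K (p i) u)%:E)%E.
    by move=> /gt0 u0; rewrite mule_ge0 ?lee_fin ?frullani_ge0.
  under eq_bigr => i _.
    rewrite -ge0_integralZl ?lee_fin//; [over|exact: measurable_frullani|].
    by move=> u /gt0 u0; rewrite lee_fin frullani_ge0.
  rewrite -ge0_integral_sum//.
  under [X in (_ <= _ + X)%E]eq_bigr => i _.
    rewrite -ge0_integralZl ?lee_fin//; [over|exact: measurable_laplace_gap|].
    by move=> u /gt0 u0; rewrite lee_fin laplace_gap_ge0.
  rewrite -ge0_integral_sum// -ge0_integralD//; last 4 first.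
  - by move=> u /gt0 u0; rewrite lee_fin frullani_ge0.
  - exact: measurable_frullani.
  - by move=> u u0; apply: sume_ge0 => i _; exact: wL0.
  - by apply: emeasurable_sum.
  apply: ge0_le_integral => //.
  - by move=> u u0; apply: sume_ge0 => i _; exact: wK0.
  - by apply: emeasurable_sum.
  - apply: emeasurable_funD; first exact: measurable_frullani.
    exact: emeasurable_sum.
  (* Once the factor 1 / u is removed and exp (- u c) cancels, the weights having sum 1, the
     pointwise inequality is [supmart]. *)
  move=> u /gt0 u0.
  under eq_bigr => i _ do rewrite -EFinM.
  under [X in (_ <= _ + X)%E]eq_bigr => i _ do rewrite -EFinM.
  rewrite !sumEFin -EFinD lee_fin.
  under eq_bigr => i _ do rewrite mulrA.
  rewrite /laplace_gap.
  under [X in _ <= _ + X]eq_bigr => i _ do rewrite mulrA.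
  rewrite -!mulr_suml -mulrDl ler_pM2r ?invr_gt0//.
  under eq_bigr => i _ do rewrite mulrBr.
  under [X in _ <= _ + X]eq_bigr => i _ do rewrite mulrBr mulr1 -expRD mulrBr.
  rewrite !sumrB -mulr_suml w1 mul1r.
  by have := supmart u u0; lra.
have Efin : (\sum_i (w i)%:E * (ln c - ln (p i))%:E)%E =
    (ln c - \sum_i w i * ln (p i))%:E.
  under eq_bigr => i _ do rewrite -EFinM mulrBr.
  by rewrite sumEFin sumrB -mulr_suml w1 mul1r.
(* Only the real number ln c - ln P changes sides; the sum of [G] stays on the right. *)
move: key; rewrite Efin -leeBlDl// -EFinB; apply: le_trans.
by rewrite lee_fin; lra.
Qed.

End laplace.

(** * Functions constant on dyadic intervals and their integrals *)

Section dyadic.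
Context {R : realType}.
Local Open Scope ring_scope.
Local Notation mu := (@lebesgue_measure R).
Local Notation D := (@unit_itv R).
Local Notation I n k := [set` @dyadic_itv R n k].

(** The left endpoint represents its interval; the left half of the interval has the same
    representative. *)
Definition dyadic_pt n k : R := k%:R * 2 ^- n.

(** The codomain is arbitrary, so that the notion covers real and extended real functions as well as
    sets, seen as functions to [Prop]. *)
Definition dyadic_cst n (T : Type) (f : R -> T) :=
  forall k x y, (k < 2 ^ n)%N -> I n k x -> I n k y -> f x = f y.

(** Scaling by 2^n turns the interval into [k, k + 1[, so the index is the integer part of the
    scaled point and is determined by [x]. *)
Lemma dyadic_itvP n k (x : R) :
  I n k x <-> 0 <= x /\ Num.truncn (x * 2 ^+ n) = k.
Proof.
rewrite /= in_itv/= ler_pdivrMr ?exprn_gt0// ltr_pdivlMr ?exprn_gt0//; split.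
  move=> /andP[kx xk].
  have x0 : 0 <= x * 2 ^+ n by exact: le_trans kx.
  split; first by move: x0; rewrite pmulr_lge0// exprn_gt0.
  by apply/eqP; rewrite eqn_leq truncn_ge_nat// kx andbT -ltnS truncn_lt_nat.
move=> [x0 <-]; have {}x0 : 0 <= x * 2 ^+ n by rewrite mulr_ge0// exprn_ge0.
by rewrite -truncn_ge_nat// -truncn_lt_nat// !leqnn.
Qed.

Lemma dyadic_itv_unit n k : (k < 2 ^ n)%N -> I n k `<=` D.
Proof.
move=> kn x; rewrite /= !in_itv/= => /andP[kx xk]; apply/andP; split.
  by apply: le_trans kx; rewrite mulr_ge0// invr_ge0 exprn_ge0.
apply: lt_le_trans xk _; rewrite ler_pdivrMr ?exprn_gt0// mul1r.
by rewrite -natrX ler_nat.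
Qed.

Lemma dyadic_itv_pt n k : I n k (dyadic_pt n k).
Proof.
by rewrite /= in_itv/= lexx/= ltr_pM2r ?invr_gt0 ?exprn_gt0// ltr_nat.
Qed.

Lemma dyadic_ptS n k : dyadic_pt n.+1 k.*2 = dyadic_pt n k.
Proof.
rewrite /dyadic_pt -muln2 natrM exprSr invfM mulrACA divff ?mulr1//.
Qed.

Lemma dyadic_itvS n k : I n k = I n.+1 k.*2 `|` I n.+1 k.*2.+1.
Proof.
apply/seteqP; split; first exact: dyadic_itv_subU.
have e0 : k.*2%:R = k%:R * 2 :> R by rewrite -muln2 natrM.
have e1 : k.*2.+1%:R = k%:R * 2 + 1 :> R by rewrite -natr1 e0.
have e2 : k.*2.+2%:R = k%:R * 2 + 2 :> R by rewrite -natr1 e1 -addrA.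
have e3 : k.+1%:R = k%:R + 1 :> R by rewrite -natr1.
move=> x; rewrite /= !in_itv/= !(ler_pdivrMr, ltr_pdivlMr) ?exprn_gt0//.
rewrite e0 e1 e2 e3 exprSr mulrA; move: (x * _) => y.
by case=> /andP[? ?]; apply/andP; split; lra.
Qed.

Lemma disjoint_dyadic_itv n j k : j != k -> [disjoint I n j & I n k].
Proof.
move=> jk; rewrite disj_set2E; apply/eqP/seteqP; split => // x [].
by move=> /dyadic_itvP[_ xj] /dyadic_itvP[_ xk]; rewrite -xj -xk eqxx in jk.
Qed.

Lemma dyadic_cstS n (T : Type) (f : R -> T) :
  dyadic_cst n f -> dyadic_cst n.+1 f.
Proof.
move=> cf k x y kn xk yk.
have sub : I n.+1 k `<=` I n k./2.
  rewrite (dyadic_itvS n) -{1}(odd_double_half k).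
  by case: (odd k) => z zk; [right|left].
apply: (cf k./2); [|exact: sub..].
by rewrite ltn_half_double -muln2 -expnSr.
Qed.

Lemma dyadic_cst_le m n (T : Type) (f : R -> T) :
  (m <= n)%N -> dyadic_cst m f -> dyadic_cst n f.
Proof.
move=> /subnK <- cf; elim: (n - m)%N => // k ih; exact: dyadic_cstS.
Qed.

(** Sets that contain all or nothing of each interval of level n form a sigma-algebra on [0, 1[ to
    which the generators belong. *)
Lemma dyadic_filtration_cst n A : @dyadic_filtration R n A -> dyadic_cst n A.
Proof.
apply: smallest_sub; first split.
- by move=> k x y.
- move=> B cB k x y kn xk yk /=.
  rewrite /setD/= (cB k x y)//; apply/propext.
  have Dx := dyadic_itv_unit kn xk; have Dy := dyadic_itv_unit kn yk.
  by split=> -[].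
- move=> F cF k x y kn xk yk; apply/propext.
  by split=> -[j _ Fj]; exists j => //;
    [rewrite -(cF j k x)|rewrite (cF j k x y)].
- move=> _ [j /= jn <-] k x y kn /dyadic_itvP[x0 xk] /dyadic_itvP[y0 yk].
  by apply/propext; split=> /dyadic_itvP[_ ?]; apply/dyadic_itvP; split; congruence.
Qed.

(** The preimage of the singleton {f y} contains y, and being in the sigma-algebra it contains the
    whole interval around y. *)
Lemma dyadic_cst_adapted n (f : R -> R) :
  preimage_set_system D f measurable `<=` @dyadic_filtration R n ->
  dyadic_cst n f.
Proof.
move=> af k x y kn xk yk.
have /dyadic_filtration_cst/(_ k x y kn xk yk) :
    @dyadic_filtration R n (D `&` f @^-1` [set f y]).
  by apply: af; exists [set f y].
move=> xy; suff: (D `&` f @^-1` [set f y]) x by case.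
by rewrite xy; split => //; exact: dyadic_itv_unit yk.
Qed.

Lemma lebesgue_dyadic_itv n k : (mu (I n k) = (2 ^- n)%:E)%E.
Proof.
transitivity (mu (`[k%:R * 2 ^- n, k.+1%:R * 2 ^- n[%classic : set R)) => //.
rewrite lebesgue_measure_itv/= lte_fin ltr_pM2r ?invr_gt0 ?exprn_gt0//.
rewrite ltr_nat leqnn -EFinD; congr _%:E.
by rewrite -mulrBl -natr1 addrAC subrr add0r mul1r.
Qed.

Lemma integral_dyadic_itv n k (f : R -> \bar R) :
  (k < 2 ^ n)%N -> dyadic_cst n f ->
  (\int[mu]_(x in I n k) f x = f (dyadic_pt n k) * (2 ^- n)%:E)%E.
Proof.
move=> kn cf.
transitivity (\int[mu]_(x in I n k) (cst (f (dyadic_pt n k)) x))%E.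
  apply: eq_integral => x; rewrite inE => xk.
  by apply: (cf k) => //; exact: dyadic_itv_pt.
rewrite integral_cst//; congr (_ * _)%E; exact: lebesgue_dyadic_itv.
Qed.

Lemma expect_dyadic n (f : R -> \bar R) : dyadic_cst n f ->
  expect f = (\sum_(k < 2 ^ n) (2 ^- n)%:E * f (dyadic_pt n k))%E.
Proof.
move=> cf.
(* The intervals are added one at a time from the left; measurability is carried along because
   additivity of the integral uses it. *)
have H m : (m <= 2 ^ n)%N ->
    measurable_fun (`[0, dyadic_pt n m[ : set R) f /\
    (\int[mu]_(x in `[0%R, dyadic_pt n m[) f x =
     \sum_(k < m) (2 ^- n)%:E * f (dyadic_pt n k))%E.
  elim: m => [|m ih] mn.
    rewrite /dyadic_pt mul0r set_itvco0 integral_set0 big_ord0; split => //.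
    exact: measurable_fun_set0.
  have [mf IHm] := ih (ltnW mn).
  have -> : (`[0, dyadic_pt n m.+1[%classic : set R) =
      `[0, dyadic_pt n m[%classic `|` I n m.
    have xin (x : R) : x \in `[0, dyadic_pt n m.+1[ =
        (x \in `[0, dyadic_pt n m[) || (x \in dyadic_itv R n m).
      apply: itv_splitU; rewrite !bnd_simp mulr_ge0 ?invr_ge0 ?exprn_ge0//=.
      by rewrite ler_pM2r ?invr_gt0 ?exprn_gt0// ler_nat.
    by apply/seteqP; split => x /=; rewrite xin => /orP.
  have mfm : measurable_fun (I n m) f.
    apply: (eq_measurable_fun (cst (f (dyadic_pt n m)))) => // x.
    rewrite inE => xm.
    by apply: (cf m) => //; exact: dyadic_itv_pt.
  have mfU : measurable_fun (`[0, dyadic_pt n m[%classic `|` I n m) f.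
    by apply/measurable_funU.
  split => //; rewrite integral_setU//; last first.
    rewrite disj_set2E; apply/eqP/seteqP; split => // x [] /=.
    rewrite !in_itv/= => /andP[_ xm] /andP[mx _].
    by move: (lt_le_trans xm mx); rewrite ltxx.
  by rewrite IHm integral_dyadic_itv// big_ord_recr/= muleC.
have [_] := H _ (leqnn _).
by rewrite /dyadic_pt natrX divff ?expf_neq0.
Qed.

Lemma sum_double_nat (V : nmodType) (f : nat -> V) m :
  \sum_(k < m.*2) f k = \sum_(k < m) (f k.*2 + f k.*2.+1).
Proof.
elim: m => [|m ih]; first by rewrite !big_ord0.
by rewrite doubleS !big_ord_recr/= ih addrA.
Qed.

(** The intervals of level n + 1 are grouped by parent: interval k has children 2k and 2k + 1, the
    first with the same left endpoint as its parent. *)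
Lemma sum_dyadic_ptS n (f : R -> R) :
  \sum_(k < 2 ^ n.+1) 2 ^- n.+1 * f (dyadic_pt n.+1 k) =
  \sum_(k < 2 ^ n) 2 ^- n *
    ((f (dyadic_pt n k) + f (dyadic_pt n.+1 k.*2.+1)) / 2).
Proof.
rewrite expnS mul2n (sum_double_nat (fun k => 2 ^- n.+1 * f (dyadic_pt n.+1 k))).
apply: eq_bigr => k _; rewrite dyadic_ptS exprS invfM -mulrDr.
by ring.
Qed.

End dyadic.

(** * Martingales along the dyadic filtration *)

Section dyadic_martingale.
Context {R : realType} (xi : nat -> R -> R).
Local Open Scope ring_scope.
Local Notation mu := (@lebesgue_measure R).
Local Notation D := (@unit_itv R).
Local Notation I n k := [set` @dyadic_itv R n k].

(** The last increment leads to [xi n], so this sum is already constant on intervals of level n. *)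
Definition partial_quad_var n x := \sum_(k < n) (xi k.+1 x - xi k x) ^+ 2.

Hypothesis xi_martingale : martingale mu D (@dyadic_filtration R) xi.

Lemma martingale_dyadic_cst n : dyadic_cst n (xi n).
Proof. by apply: dyadic_cst_adapted; have [/(_ n)[]] := xi_martingale. Qed.

Lemma partial_quad_var_dyadic_cst n : dyadic_cst n (partial_quad_var n).
Proof.
move=> k x y kn xk yk; apply: eq_bigr => j _; congr ((_ - _) ^+ 2).
  exact: (dyadic_cst_le (ltn_ord j) (@martingale_dyadic_cst j.+1)) xk yk.
exact: (dyadic_cst_le (ltnW (ltn_ord j)) (@martingale_dyadic_cst j)) xk yk.
Qed.

Lemma dyadic_itv_odd_sub n k : I n.+1 k.*2.+1 `<=` I n k.
Proof. by rewrite (dyadic_itvS n); exact: subsetUr. Qed.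

(** The conditional expectation identity is tested on a single interval of level n, whose halves
    carry equal mass. *)
Lemma martingale_dyadic_half n k : (k < 2 ^ n)%N ->
  xi n (dyadic_pt n k) =
  (xi n.+1 (dyadic_pt n k) + xi n.+1 (dyadic_pt n.+1 k.*2.+1)) / 2.
Proof.
move=> kn; have [int_xi cexp] := xi_martingale.
have [_ _ /(_ (I n k))] := cexp n.
have Fk : @dyadic_filtration R n (I n k) by apply: sub_sigma_algebra; exists k.
move=> /(_ Fk).
rewrite (integral_dyadic_itv (f := EFin \o xi n)) //; last first.
  by move=> j x y jn xj yj /=; rewrite (martingale_dyadic_cst jn xj yj).
have c1 : dyadic_cst n.+1 (EFin \o xi n.+1).
  by move=> j x y jn xj yj /=; rewrite (martingale_dyadic_cst jn xj yj).
have k1 : (k.*2.+1 < 2 ^ n.+1)%N.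
  by rewrite expnS mul2n -doubleS leq_double.
have mxi : measurable_fun (I n k) (EFin \o xi n.+1).
  have [[/measurable_int mD _] _] := int_xi n.+1.
  by apply: (measurable_funS _ (dyadic_itv_unit kn) mD); exact: measurable_itv.
rewrite [in RHS]dyadic_itvS integral_setU//; last 2 first.
- by rewrite -dyadic_itvS.
- by apply: disjoint_dyadic_itv; rewrite neq_ltn ltnSn.
rewrite !integral_dyadic_itv//; last exact: ltnW.
rewrite dyadic_ptS /= -!EFinM -EFinD => -[] H.
apply: (@mulIf _ (2 ^- n)); first by rewrite invr_neq0// expf_neq0.
rewrite H exprSr invfM; ring.
Qed.

Lemma martingale_mean n :
  \sum_(k < 2 ^ n) 2 ^- n * xi n (dyadic_pt n k) = xi 0 (dyadic_pt 0 0).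
Proof.
elim: n => [|n <-]; first by rewrite big_ord1 invr1 mul1r.
rewrite sum_dyadic_ptS; apply: eq_bigr => k _.
by rewrite (martingale_dyadic_half (ltn_ord k)).
Qed.

(* One step is the bound [cosh (u a) <= exp (u^2 a^2 / 2)], where [+a] and [-a]
   are the increments of [xi] on the two halves of a dyadic interval. *)
Lemma exp_supermartingale (u : R) n :
  \sum_(k < 2 ^ n) 2 ^- n *
     expR (- (u * xi n (dyadic_pt n k)) -
           u ^+ 2 * partial_quad_var n (dyadic_pt n k) / 2) <=
  expR (- (u * xi 0 (dyadic_pt 0 0))).
Proof.
elim: n => [|n]; last apply: le_trans.
  by rewrite big_ord1 invr1 mul1r /partial_quad_var big_ord0 mulr0 mul0r subr0.
rewrite (sum_dyadic_ptS n (fun x =>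
  expR (- (u * xi n.+1 x) - u ^+ 2 * partial_quad_var n.+1 x / 2))).
apply: ler_sum => k _; rewrite ler_pM2l ?invr_gt0 ?exprn_gt0//.
set x := dyadic_pt n k; set y := dyadic_pt n.+1 k.*2.+1.
have kn := ltn_ord k.
have xI : I n k x by exact: dyadic_itv_pt.
have yI : I n k y by apply: dyadic_itv_odd_sub; exact: dyadic_itv_pt.
have xiy := martingale_dyadic_cst kn yI xI.
have qvy := partial_quad_var_dyadic_cst kn yI xI.
have half := martingale_dyadic_half kn; rewrite -/x -/y in half.
have qS z : partial_quad_var n.+1 z =
    partial_quad_var n z + (xi n.+1 z - xi n z) ^+ 2.
  by rewrite /partial_quad_var big_ord_recr.
rewrite !qS qvy xiy.
set q := partial_quad_var n x; set m := xi n x.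
pose a := xi n.+1 x - m.
have -> : xi n.+1 x = m + a by rewrite /a; ring.
have -> : xi n.+1 y = m - a by rewrite /a /m half; field.
have -> : - (u * (m + a)) - u ^+ 2 * (q + (m + a - m) ^+ 2) / 2 =
  (- (u * m) - u ^+ 2 * q / 2) - (u * a) ^+ 2 / 2 - u * a by field.
have -> : - (u * (m - a)) - u ^+ 2 * (q + (m - a - m) ^+ 2) / 2 =
  (- (u * m) - u ^+ 2 * q / 2) - (u * a) ^+ 2 / 2 + u * a by field.
(* With [e] the exponent at level n and [b] the scaled increment, what remains is exp e exp (- b^2 /
   2) cosh b <= exp e. *)
move: (- (u * m) - _) (u * a) => e b.
rewrite !(expRD (e - _)) (expRD e) expRN.
rewrite -mulrDr ler_pdivrMr// -mulrA ler_pM2l ?expR_gt0//.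
by rewrite ler_pdivrMl ?expR_gt0// mulrC addrC expR_cosh_le.
Qed.

Lemma quad_var_stop N x : (forall n, (N <= n)%N -> xi n x = xi N x) ->
  quad_var xi x = (partial_quad_var N x)%:E.
Proof.
move=> stop; rewrite /quad_var (nneseries_split 0 N); last first.
  by move=> k _; rewrite lee_fin sqr_ge0.
rewrite eseries0 ?adde0; last first.
  by move=> k Nk _; rewrite add0n in Nk; rewrite !stop ?leqW// subrr expr0n.
by rewrite add0n big_mkord sumEFin.
Qed.

End dyadic_martingale.

Theorem theorem1p3 (R : realType) (xi : nat -> R -> R) (xi_inf : R -> R)
    (N : nat)
    (xi_martingale : martingale (@lebesgue_measure R) (@unit_itv R)
                       (@dyadic_filtration R) xi)
    (xi_pos : forall n x, unit_itv x -> (0 < xi n x)%R)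
    (xi_stop : forall n x, (N <= n)%N -> unit_itv x -> xi n x = xi_inf x)
    (xi_inf_pos : forall x, unit_itv x -> (0 < xi_inf x)%R) :
  lne (expect (fun x => (xi_inf x)%:E)) - expect (fun x => (ln (xi_inf x))%:E)
  <= expect (fun x => G ((xi_inf x)%:E / sqrte (quad_var xi x))).
Proof.
have xiN x : unit_itv x -> xi_inf x = xi N x by move=> /xi_stop ->.
have pt_unit n k : (k < 2 ^ n)%N -> unit_itv (@dyadic_pt R n k).
  by move=> kn; apply: (dyadic_itv_unit kn); exact: dyadic_itv_pt.
have cxi : dyadic_cst N (xi N) by exact: martingale_dyadic_cst.
have cqv : dyadic_cst N (partial_quad_var xi N).
  by exact: partial_quad_var_dyadic_cst.
(* [xi_inf] and [xi N] are known to agree on [0, 1[ only, so one replaces the other under the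
   integrals. *)
have expect_eq f g : (forall x : R, unit_itv x -> f x = g x) ->
    expect f = expect g.
  by move=> fg; apply: eq_integral => x; rewrite inE => /fg.
rewrite (expect_eq (fun x => (xi_inf x)%:E) (fun x => (xi N x)%:E)); last first.
  by move=> x /xiN ->.
rewrite (expect_eq (fun x => (ln (xi_inf x))%:E)
    (fun x => (ln (xi N x))%:E)); last first.
  by move=> x /xiN ->.
rewrite (expect_eq (fun x => G ((xi_inf x)%:E / sqrte (quad_var xi x)))
    (fun x => G ((xi N x)%:E / sqrte (partial_quad_var xi N x)%:E))); last first.
  move=> x Dx; rewrite xiN// (quad_var_stop (N := N))// => n Nn.
  by rewrite (xi_stop _ _ Nn Dx) xiN.
(* All three integrands are now constant on intervals of level [N], so the expectations become sums
   of 2^N terms of weight 2^-N. *)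
rewrite !(expect_dyadic (n := N)); last 3 first.
- by move=> k x y kn xk yk; rewrite (cxi _ _ _ kn xk yk) (cqv _ _ _ kn xk yk).
- by move=> k x y kn xk yk; rewrite (cxi _ _ _ kn xk yk).
- by move=> k x y kn xk yk; rewrite (cxi _ _ _ kn xk yk).
under eq_bigr do rewrite -EFinM.
under [X in _ - X]eq_bigr do rewrite -EFinM.
(* The mean is the constant value of [xi 0], a positive real, so [lne] reduces to [ln]. *)
rewrite !sumEFin martingale_mean// lne_EFin; last exact/xi_pos/pt_unit.
rewrite -EFinB; apply: ln_sub_mean_ln_le_G.
- by move=> k; rewrite invr_ge0 exprn_ge0.
- by rewrite sumr_const card_ord -(mulr_natl (2 ^- N)) natrX divff// expf_neq0.
- by move=> k; exact/xi_pos/pt_unit.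
- by move=> k; apply: sumr_ge0 => j _; exact: sqr_ge0.
- exact/xi_pos/pt_unit.
- by move=> u _; exact: exp_supermartingale.
Qed.
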